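(* For every $n\geq 2$ the free group $F=F_{n}$ of rank $n$ has a primitive, but not $2$-transitive action on a countable set $X$, such that for each finite subset $Y\subseteq X$ the pointwise stabilizer $F_{Y}$ is nontrivial and every nontrivial subnormal subgroup of $F$ is transitive on $X$.
   Context: An action of a group $\Gamma$ on a set $X$ is primitive if it is transitive and a point stabilizer is a maximal subgroup of $\Gamma$ (equivalently, there is no nontrivial $\Gamma$-invariant equivalence relation on $X$). It is $2$-transitive if $\Gamma$ acts transitively on ordered pairs of distinct elements of $X$. A subgroup $H\le G$ is subnormal if there is a finite chain $H=G_m\lhd G_{m-1}\lhd\dots\lhd G_0=G$. *)

(* Defs.v *)
From HB Require Import structures.
From mathcomp Require Import all_boot.
From mathcomp Require Import boolp classical_sets functions cardinality.

Set Implicit Arguments.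
Unset Strict Implicit.
Unset Printing Implicit Defensive.

Local Open Scope group_scope.
Local Open Scope classical_set_scope.

(* The letter (a, true) stands for the generator a and (a, false) for its
   inverse; elements of the free group on A are the reduced words. *)
Section FreeGroup.
Variable A : choiceType.
Implicit Types (x : A * bool) (u v w : seq (A * bool)).

Definition letter_inv x : A * bool := (x.1, ~~ x.2).

Definition reduced : pred (seq (A * bool)) :=
  sorted (fun x y => y != letter_inv x).

Record free_group := FreeGroup { word :> seq (A * bool); _ : reduced word }.

HB.instance Definition _ := [isSub for word].
HB.instance Definition _ := [Choice of free_group by <:].

Definition push x w :=
  if w is y :: w' then if y == letter_inv x then w' else x :: w else [:: x].

(* For reduced u and v, this is the reduced form of u ++ v. *)
Definition word_mul u v := foldr push v u.

Definition word_inv u := rev (map letter_inv u).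

Lemma letter_invK : involutive letter_inv.
Proof. by case=> a b; rewrite /letter_inv /= negbK. Qed.

Lemma reduced_behead x w : reduced (x :: w) -> reduced w.
Proof. exact: path_sorted. Qed.

Lemma push_reduced x w : reduced w -> reduced (push x w).
Proof.
case: w => [|y w] //= yw; case: ifPn => [_|ny]; first exact: path_sorted yw.
by rewrite /= ny.
Qed.

Lemma word_mul_reduced u v : reduced v -> reduced (word_mul u v).
Proof. by move=> rv; elim: u => //= x u IH; exact: push_reduced. Qed.

Lemma pushK x w : reduced w -> push x (push (letter_inv x) w) = w.
Proof.
case: w => [|y w] /=; first by rewrite eqxx.
rewrite letter_invK => yw; case: eqP => [eyx|_]; last by rewrite /= eqxx.
case: w yw => [|z w] /=; first by rewrite eyx.
by rewrite eyx => /andP[/negbTE->].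
Qed.

Lemma word_mul_push x u v : reduced v ->
  word_mul (push x u) v = push x (word_mul u v).
Proof.
move=> rv; case: u => [|y u] //=; case: eqP => [->|] //=.
by rewrite pushK //; exact: word_mul_reduced.
Qed.

Lemma word_mulA u v w : reduced w ->
  word_mul u (word_mul v w) = word_mul (word_mul u v) w.
Proof. by move=> rw; elim: u => //= x u ->; rewrite word_mul_push. Qed.

Lemma word_mul0 u : reduced u -> word_mul u [::] = u.
Proof.
elim: u => //= x u IH xu; rewrite IH; last exact: reduced_behead xu.
by case: u xu {IH} => [|y u] //= /andP[/negbTE->].
Qed.

Lemma word_inv_reduced u : reduced u -> reduced (word_inv u).
Proof.
rewrite /word_inv /reduced rev_sorted sorted_map; apply: sub_sorted => x y /=.
by apply: contraNneq => ->; rewrite letter_invK.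
Qed.

Lemma word_mul_cat u v w : word_mul (u ++ v) w = word_mul u (word_mul v w).
Proof. exact: foldr_cat. Qed.

Lemma word_invK : involutive word_inv.
Proof.
by move=> u; rewrite /word_inv map_rev revK mapK //; exact: letter_invK.
Qed.

Lemma word_mulKV u v : reduced v -> word_mul (word_inv u) (word_mul u v) = v.
Proof.
move=> rv; elim: u => [|x u IH] //=.
rewrite /word_inv map_cons rev_cons -cats1 word_mul_cat /= -{2}[x]letter_invK.
by rewrite pushK //; exact: word_mul_reduced.
Qed.

Definition fg_one : free_group := @FreeGroup [::] isT.

Definition fg_mul (u v : free_group) : free_group :=
  FreeGroup (word_mul_reduced u (valP v)).

Definition fg_inv (u : free_group) : free_group :=
  FreeGroup (word_inv_reduced (valP u)).

Fact fg_mulA : associative fg_mul.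
Proof. by move=> u v w; apply: val_inj; exact: (word_mulA _ _ (valP w)). Qed.

Fact fg_mul1 : left_id fg_one fg_mul.
Proof. by move=> u; exact: val_inj. Qed.

Fact fg_mulr1 : right_id fg_one fg_mul.
Proof. by move=> u; apply: val_inj; exact: (word_mul0 (valP u)). Qed.

Fact fg_mulV : left_inverse fg_one fg_inv fg_mul.
Proof.
move=> u; apply: val_inj => /=.
by rewrite -{2}(word_mul0 (valP u)) word_mulKV.
Qed.

Fact fg_mulrV : right_inverse fg_one fg_inv fg_mul.
Proof.
move=> u; rewrite -{1}[u](_ : fg_inv (fg_inv u) = u) ?fg_mulV //.
by apply: val_inj; exact: word_invK.
Qed.

HB.instance Definition _ :=
  isGroup.Build free_group fg_mulA fg_mul1 fg_mulr1 fg_mulV fg_mulrV.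

Definition fg_gen (a : A) : free_group := @FreeGroup [:: (a, true)] isT.

End FreeGroup.

Section UniversalProperty.
Variables (A : choiceType) (G : groupType) (f : A -> G).

Definition letter_eval (x : A * bool) : G := if x.2 then f x.1 else (f x.1)^-1.

Definition word_eval (w : seq (A * bool)) : G := \prod_(x <- w) letter_eval x.

Lemma letter_evalV x : letter_eval (letter_inv x) = (letter_eval x)^-1.
Proof. by case: x => a []; rewrite /letter_eval //= invgK. Qed.

Lemma word_eval_push x w : word_eval (push x w) = letter_eval x * word_eval w.
Proof.
rewrite /word_eval; case: w => [|y w] /=; first by rewrite !big_cons big_nil.
case: eqP => [->|_]; last by rewrite !big_cons.
by rewrite [in RHS]big_cons letter_evalV mulgA mulgV mul1g.
Qed.

Lemma word_evalM u v : word_eval (word_mul u v) = word_eval u * word_eval v.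
Proof.
elim: u => [|x u IH] /=; first by rewrite {2}/word_eval big_nil mul1g.
by rewrite word_eval_push IH mulgA /word_eval big_cons.
Qed.

Theorem free_group_universal :
  exists! phi : free_group A -> G,
    {morph phi : u v / u * v} /\ forall a, phi (fg_gen a) = f a.
Proof.
exists (fun u => word_eval (word u)); split.
  by split=> [u v|a]; [exact: word_evalM|rewrite /word_eval big_seq1].
move=> phi [phiM phig]; apply/funext => -[w rw] /=.
have phi1 : phi 1 = 1.
  by apply: (@mulgI _ (phi 1)); rewrite -phiM !mulg1.
have phil x (rx : reduced [:: x]) : phi (FreeGroup rx) = letter_eval x.
  case: x rx => a [] rx.
    by rewrite /letter_eval /= -phig; congr phi; exact: val_inj.
  rewrite /letter_eval /= -phig; apply: (@mulgI _ (phi (fg_gen a))).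
  rewrite mulgV -phiM -phi1; congr phi; apply: val_inj => /=.
  by rewrite /letter_inv /= eqxx.
elim: w rw => [|x w IH] rw.
  by rewrite /word_eval big_nil -phi1; congr phi; exact: val_inj.
have rw' := reduced_behead rw.
have rx : reduced [:: x] by [].
rewrite /word_eval big_cons -(phil x rx).
have /= := IH rw'; rewrite /word_eval => ->.
rewrite -phiM; congr phi; apply: val_inj => /=.
by case: w rw {IH rw'} => [|y w] //= /andP[/negbTE->].
Qed.

End UniversalProperty.

Section Subgroups.
Variable G : groupType.
Implicit Types H K N : set G.

Definition subgroup H : Prop :=
  [/\ H 1, forall x y, H x -> H y -> H (x * y) & forall x, H x -> H x^-1].

Definition nontrivial H : Prop := exists2 x, H x & x <> 1.

Definition normal_subgroup N K : Prop :=
  [/\ subgroup N, N `<=` K & forall x y, N x -> K y -> N (x ^ y)].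

Definition subnormal H : Prop :=
  exists (m : nat) (C : nat -> set G),
    [/\ C 0 = setT, C m = H &
        forall i, (i < m)%N -> normal_subgroup (C i.+1) (C i)].

Definition maximal_subgroup H : Prop :=
  [/\ subgroup H, H <> setT &
      forall K, subgroup K -> H `<=` K -> K = H \/ K = setT].

End Subgroups.

Record group_action (G : groupType) (X : Type) := GroupAction {
  act :> G -> X -> X;
  act1 : forall x, act 1 x = x;
  actM : forall g h x, act (g * h) x = act g (act h x)
}.

Section Actions.
Variables (G : groupType) (X : Type) (a : group_action G X).

Definition transitive_on (H : set G) : Prop :=
  forall x y : X, exists2 g, H g & a g x = y.

Definition point_stabilizer (x : X) : set G := [set g | a g x = x].

Definition pointwise_stabilizer (Y : set X) : set G :=
  [set g | forall y, Y y -> a g y = y].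

Definition primitive_action : Prop :=
  [/\ [set: X] !=set0, transitive_on setT &
      forall x, maximal_subgroup (point_stabilizer x)].

Definition two_transitive_action : Prop :=
  forall x1 x2 y1 y2 : X, x1 <> x2 -> y1 <> y2 ->
    exists g, a g x1 = y1 /\ a g x2 = y2.

End Actions.

(* Main.v *)
Require Import Defs.
From HB Require Import structures.
From mathcomp Require Import all_boot.
From mathcomp Require Import finmap.
From mathcomp Require Import boolp classical_sets functions cardinality.

Set Implicit Arguments.
Unset Strict Implicit.
Unset Printing Implicit Defensive.

Local Open Scope group_scope.
Local Open Scope classical_set_scope.

(** Let F be free on a countable set with at least two generators s and t.

    The heart of the matter is a highly transitive action of F on a countable
    set in which every nontrivial element moves infinitely many points.  Start
    from F acting on itself by left multiplication, keep every generator except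
    t, and replace t by a generic permutation, built from finite partial
    injections by meeting countably many requirements one at a time
    ([generic_permutation]).  Two kinds of requirements are used.  Given two
    tuples of distinct points, powers of s push both of them off the finitely
    many points where t is already prescribed, and t may then be told to send
    the first pushed tuple to the second one; hence high transitivity.  Given a
    word w, somewhere far away t may be told to be the left multiplication it
    was originally, along the whole path that w follows from a point g; there w
    acts as g |-> w * g, so it moves g.  This gives
    [free_group_highly_transitive_action].

    High transitivity passes to a normal subgroup N ([highly_transitive_normal]):
    an element n of N that moves infinitely many points sends some tuple ps of
    distinct points to a tuple disjoint from it, and conjugating n by an element
    that takes two given disjoint tuples to ps and n ps produces an element of N
    between these tuples.  Descending along a subnormal chain, every nontrivial
    subnormal subgroup is highly transitive.

    The set X consists of the two-element subsets of the points.  On X the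
    action is transitive on the pairs (P, Q) with a given number of common
    points ([pair_orbital]), so there are exactly two orbits of pairs of
    distinct elements, and the action is not 2-transitive.  It is primitive
    because any two elements of X are joined by a path of length two in each of
    the two orbital graphs ([pair_intermediate]).  Finally, high transitivity
    directly provides nontrivial elements fixing finitely many points. *)

(** * Generic permutations of a countable set *)

(** Infinity as it is used throughout: a fresh point outside any finite list. *)
Definition infinite_type (T : eqType) := forall l : seq T, exists x, x \notin l.

Section GenericPermutation.
Variable T : countType.
Implicit Types (r s : seq (T * T)) (p q : T * T).

(** A finite set of prescribed values, read as a relation that is both
    single-valued and injective; repeated entries are harmless. *)
Definition partial_injection s :=
  {in s &, forall p q, (p.1 == q.1) = (p.2 == q.2)}.

Lemma partial_injection_cat r s :
  partial_injection r -> partial_injection s ->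
  {in r & s, forall p q, (p.1 != q.1) && (p.2 != q.2)} ->
  partial_injection (r ++ s).
Proof.
move=> ir is_ rs p q; rewrite !mem_cat => /orP[pr|ps] /orP[qr|qs].
- exact: ir.
- by have /andP[/negbTE-> /negbTE->] := rs _ _ pr qs.
- by rewrite eq_sym [RHS]eq_sym; have /andP[/negbTE-> /negbTE->] := rs _ _ qr ps.
- exact: is_.
Qed.

Lemma partial_injection_cons x y s :
  (forall b, (x, b) \notin s) -> (forall a, (a, y) \notin s) ->
  partial_injection s -> partial_injection ((x, y) :: s).
Proof.
move=> xs ys is_; apply: (@partial_injection_cat [:: (x, y)]) => //.
  by move=> p q; rewrite !inE => /eqP-> /eqP->; rewrite !eqxx.
move=> p [a b]; rewrite inE => /eqP-> /= ab; apply/andP; split.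
  by apply: contraTneq ab => <-.
by apply: contraTneq ab => <-.
Qed.

Lemma mem_zip (xs ys : seq T) p :
  p \in zip xs ys -> (p.1 \in xs) && (p.2 \in ys).
Proof.
elim: xs ys => [|x xs IH] [|y ys] //=; rewrite !inE => /orP[/eqP->|/IH].
  by rewrite !eqxx.
by case/andP=> -> ->; rewrite !orbT.
Qed.

Lemma partial_injection_zip (xs ys : seq T) :
  uniq xs -> uniq ys -> size xs = size ys -> partial_injection (zip xs ys).
Proof.
move=> uxs uys sxy p q; have [x0 y0] := p.
have sz : size (zip xs ys) = size xs by rewrite size_zip -sxy minnn.
move=> /(nthP (x0, y0))[i + <-] /(nthP (x0, y0))[j + <-].
by rewrite sz !nth_zip // => ilt jlt /=; rewrite !nth_uniq -?sxy.
Qed.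

Lemma partial_injection_limit (S : nat -> seq (T * T)) :
  (forall k, partial_injection (S k)) ->
  {homo S : i j / (i <= j)%N >-> {subset i <= j}} ->
  (forall x, exists y k, (x, y) \in S k) ->
  (forall y, exists x k, (x, y) \in S k) ->
  exists t t' : T -> T, [/\ cancel t t', cancel t' t &
    forall k, {in S k, forall p, t p.1 = p.2}].
Proof.
move=> iS monoS domS ranS.
have SE k l p q : p \in S k -> q \in S l -> (p.1 == q.1) = (p.2 == q.2).
  move=> pk ql; apply: (iS (maxn k l)).
    exact: monoS (leq_maxl _ _) _ pk.
  exact: monoS (leq_maxr _ _) _ ql.
have [t tP] := choice domS; have [t' t'P] := choice ranS.
exists t, t'; split.
- move=> x; have [k kx] := tP x; have [l lx] := t'P (t x).
  by apply/eqP; rewrite (SE _ _ _ _ lx kx) /=.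
- move=> y; have [k ky] := t'P y; have [l ly] := tP (t' y).
  by apply/eqP; rewrite -(SE _ _ _ _ ly ky) /=.
- move=> k [x y] xy /=; have [l lx] := tP x.
  by apply/eqP; rewrite -(SE _ _ _ _ lx xy) /=.
Qed.

(** A Baire category argument.  Every requirement [D i] can be met by adding
    finitely many prescribed values [r] to any finite partial injection, so a
    single permutation can meet all of them: treat them in turn along an
    enumeration, together with the requirements that each point get a value and
    a preimage, and take the union. *)
Lemma generic_permutation (I : countType) (D : I -> seq (T * T) -> Prop) :
  infinite_type T ->
  (forall i s, partial_injection s ->
     exists2 r, partial_injection (r ++ s) & D i r) ->
  exists t t' : T -> T, [/\ cancel t t', cancel t' t &
    forall i, exists2 r, D i r & {in r, forall p, t p.1 = p.2}].
Proof.
move=> Tinf Ddense.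
(* The summands T + T ask for a value, resp. a preimage, of each point. *)
pose E (j : I + (T + T)) r := match j with
  | inl i => D i r
  | inr (inl x) => exists y, (x, y) \in r
  | inr (inr y) => exists x, (x, y) \in r
  end.
have Edense j s : partial_injection s ->
    exists s', [/\ partial_injection s', {subset s <= s'} &
      exists2 r, E j r & {subset r <= s'}].
  move=> is_; case: j => [i|[x|y]].
  - have [r irs Dr] := Ddense i s is_; exists (r ++ s); split=> //.
      by move=> p; rewrite mem_cat orbC => ->.
    by exists r => // p; rewrite mem_cat => ->.
  - have [[y xy]|nx] := pselect (exists y, (x, y) \in s).
      exists s; split=> //; exists [:: (x, y)]; first by exists y; rewrite inE.
      by move=> p; rewrite inE => /eqP->.
    have [y ny] := Tinf (map snd s).
    exists ((x, y) :: s); split.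
    + apply: partial_injection_cons => // [b|c].
        by apply/negP => xb; apply: nx; exists b.
      by apply: contra ny => cy; apply/mapP; exists (c, y).
    + by move=> p ps; rewrite inE ps orbT.
    + exists [:: (x, y)]; first by exists y; rewrite inE.
      by move=> p; rewrite !inE => ->.
  - have [[x xy]|ny] := pselect (exists x, (x, y) \in s).
      exists s; split=> //; exists [:: (x, y)]; first by exists x; rewrite inE.
      by move=> p; rewrite inE => /eqP->.
    have [x nx] := Tinf (map fst s).
    exists ((x, y) :: s); split.
    + apply: partial_injection_cons => // [b|c].
        by apply: contra nx => xb; apply/mapP; exists (x, b).
      by apply/negP => cy; apply: ny; exists c.
    + by move=> p ps; rewrite inE ps orbT.
    + exists [:: (x, y)]; first by exists x; rewrite inE.
      by move=> p; rewrite !inE => ->.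
have /choice[step stepP] : forall js : (I + (T + T)) * seq (T * T),
    exists s', partial_injection js.2 ->
    [/\ partial_injection s', {subset js.2 <= s'} &
      exists2 r, E js.1 r & {subset r <= s'}].
  move=> [j s] /=; have [is_|nis] := pselect (partial_injection s).
    by have [s' ?] := Edense j s is_; exists s'.
  by exists s.
pose S := fix S (k : nat) : seq (T * T) := if k is k'.+1 then
  (if choice.unpickle k' is Some j then step (j, S k') else S k') else [::].
have iS k : partial_injection (S k).
  elim: k => [|k IH] //=; case: (choice.unpickle _) => [j|] //.
  by have [] := stepP (j, S k) IH.
have monoS : {homo S : i j / (i <= j)%N >-> {subset i <= j}}.
  apply: homo_leq => [s p //|r s s' rs ss p /rs/ss //|k /=].
  by case: (choice.unpickle _) => [j|] //; have [] := stepP (j, S k) (iS k).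
have SE j : exists2 r, E j r & {subset r <= S (choice.pickle j).+1}.
  by rewrite /= choice.pickleK; have [] := stepP (j, S (choice.pickle j)) (iS _).
have [|| t [t' [tK t'K tS]]] := partial_injection_limit iS monoS.
- move=> x; have [r [y xy] rS] := SE (inr (inl x)).
  by exists y, (choice.pickle (inr (inl x) : I + (T + T))).+1; apply: rS.
- move=> y; have [r [x xy] rS] := SE (inr (inr y)).
  by exists x, (choice.pickle (inr (inr y) : I + (T + T))).+1; apply: rS.
exists t, t'; split=> // i; have [r Dr rS] := SE (inl i).
by exists r => // p pr; apply: (tS (choice.pickle (inl i : I + (T + T))).+1); apply: rS.
Qed.

End GenericPermutation.

(** * Actions of free groups *)

HB.instance Definition _ (A : countType) := [Countable of free_group A by <:].

Section LetterAction.
Variables (A : choiceType) (T : Type) (L : A * bool -> T -> T).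
Hypothesis LK : forall x, cancel (L (letter_inv x)) (L x).

Lemma foldr_word_mul u v z :
  foldr L z (word_mul u v) = foldr L (foldr L z v) u.
Proof.
elim: u => //= x u <-; case: (word_mul u v) => //= y w.
by case: eqP => // ->; rewrite LK.
Qed.

Definition letter_action : group_action (free_group A) T :=
  @GroupAction _ _ (fun u z => foldr L z (word u)) (fun=> erefl)
    (fun u v z => foldr_word_mul (word u) (word v) z).

End LetterAction.

(** * Highly transitive actions *)

Section GroupActionTheory.
Variables (G : groupType) (T : choiceType) (a : group_action G T).
Implicit Types (g : G) (H K : set G).

Lemma actK g : cancel (a g) (a g^-1).
Proof. by move=> x; rewrite -actM mulVg act1. Qed.

Lemma actKV g : cancel (a g^-1) (a g).
Proof. by move=> x; rewrite -actM mulgV act1. Qed.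

Lemma act_inj g : injective (a g).
Proof. exact: can_inj (actK g). Qed.

Definition highly_transitive H :=
  forall xs ys : seq T, uniq xs -> uniq ys -> size xs = size ys ->
  exists2 g, H g & map (a g) xs = ys.

Definition infinite_supports :=
  forall g, g <> 1 -> forall l : seq T, exists2 x, x \notin l & a g x <> x.

End GroupActionTheory.

(** * A highly transitive action of the free group *)

Section FreeAction.
Variable A : countType.
Local Notation F := (free_group A).
Implicit Types (x : A * bool) (g h : F) (l : seq F).

Definition letter x : F := @FreeGroup A [:: x] isT.

Definition eval_word w : F := foldr (fun x g => letter x * g) 1 w.

Lemma eval_wordK g : eval_word (word g) = g.
Proof.
apply: val_inj => /=; rewrite -[RHS]word_mul0; last exact: valP.
by elim: (word g) => //= x w ->.
Qed.

Lemma letter_invV x : letter (letter_inv x) = (letter x)^-1.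
Proof. by apply: val_inj. Qed.

(** The word of [fg_gen a ^+ m] has length [m], so a power larger than the
    length of every word in [l] is not in [l]. *)
Lemma gen_powers_infinite a l : exists m, fg_gen a ^+ m \notin l.
Proof.
have powE m : word (fg_gen a ^+ m) = nseq m (a, true).
  elim: m => [//|m IH]; rewrite expgS [LHS]/= IH.
  by case: (m) => [|k] //=; rewrite /letter_inv /= xpair_eqE andbF.
exists (\max_(g <- l) size (word g)).+1; apply/negP => lm.
have := @leq_bigmax_seq _ l xpredT (size \o @word A) _ lm isT.
by rewrite /= powE size_nseq ltnn.
Qed.

Lemma free_group_infinite (a : A) : infinite_type F.
Proof. by move=> l; have [m] := gen_powers_infinite a l; exists (fg_gen a ^+ m). Qed.

Lemma gen_powers_escape a l l' :
  exists m, forall g, g \in l' -> fg_gen a ^+ m * g \notin l.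
Proof.
have [m ml] := gen_powers_infinite a [seq h * g^-1 | h <- l, g <- l'].
exists m => g gl'; apply: contra ml => mgl.
by apply/allpairsP; exists (fg_gen a ^+ m * g, g); rewrite /= mulgK.
Qed.

(** The requirements on the permutation that will replace left multiplication
    by [t].  The first kind links, through powers of [s], a tuple [xs] to a
    tuple [ys]; the second kind asks for a point [g] outside [l] from which
    left multiplication by [t] is unchanged along the translates [hs] of [g]. *)
Definition requirement (s t : A) (i : (seq F * seq F) + (seq F * seq F))
    (r : seq (F * F)) : Prop :=
  match i with
  | inl (xs, ys) => uniq xs -> uniq ys -> size xs = size ys ->
      exists m k, {subset zip [seq fg_gen s ^+ m * g | g <- xs]
                              [seq fg_gen s ^+ k * g | g <- ys] <= r}
  | inr (hs, l) => exists2 g, g \notin l &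
      forall h, h \in hs -> (h * g, fg_gen t * (h * g)) \in r
  end.

(** Both kinds can be met outside finitely many prescribed values because
    translates by powers of [s], or by an arbitrary element, escape every finite
    set. *)
Lemma requirement_dense s t i r0 : partial_injection r0 ->
  exists2 r, partial_injection (r ++ r0) & requirement s t i r.
Proof.
have solve (h g k : F) : h * g = k -> g = h^-1 * k by move=> <-; rewrite mulKg.
move=> ir0; case: i => [[xs ys]|[hs l]] /=; last first.
  have [g] := free_group_infinite s
    (l ++ [seq h^-1 * p.1 | h <- hs, p <- r0]
       ++ [seq (fg_gen t * h)^-1 * p.2 | h <- hs, p <- r0]).
  rewrite !mem_cat !negb_or => /and3P[gl gdom gran].
  exists [seq (h * g, fg_gen t * (h * g)) | h <- hs]; last first.
    by exists g => // h hhs; apply/mapP; exists h.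
  apply: partial_injection_cat => //.
    move=> p q /mapP[h hhs ->] /mapP[h' h'hs ->] /=.
    by rewrite (inj_eq (mulgI _)).
  move=> p q /mapP[h hhs ->] qr0 /=; apply/andP; split.
    apply: contra gdom => /eqP hg; apply/allpairsP; exists (h, q).
    by split=> //; apply: solve.
  apply: contra gran => /eqP hg; apply/allpairsP; exists (h, q).
  by split=> //; apply: solve; rewrite -hg mulgA.
have [[uxs uys sxy]|nxy] := pselect [/\ uniq xs, uniq ys & size xs = size ys];
  last by exists [::] => // *; case: nxy.
have [m mxs] := gen_powers_escape s (map fst r0) xs.
have [k kys] := gen_powers_escape s (map snd r0) ys.
exists (zip [seq fg_gen s ^+ m * g | g <- xs] [seq fg_gen s ^+ k * g | g <- ys]);
  last by move=> _ _ _; exists m, k.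
apply: partial_injection_cat => //.
  by apply: partial_injection_zip; rewrite ?map_inj_uniq ?size_map //;
    exact: mulgI.
move=> p q /mem_zip/andP[/mapP[x xxs ->] /mapP[y yys ->]] qr0.
by apply/andP; split; [apply: contraNneq (mxs _ xxs) | apply: contraNneq (kys _ yys)]
  => ->; apply: map_f.
Qed.

Theorem free_group_highly_transitive_action (s t : A) : s != t ->
  exists a : group_action F F, highly_transitive a setT /\ infinite_supports a.
Proof.
move=> nst.
have [tau [tau' [tauK tau'K tauP]]] := generic_permutation (free_group_infinite s)
  (requirement_dense s t).
pose L x g : F := if x.1 == t then if x.2 then tau g else tau' g else letter x * g.
have LK x : cancel (L (letter_inv x)) (L x).
  move=> g; rewrite /L /=; case: eqP => _; last by rewrite letter_invV mulgA mulgV mul1g.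
  by case: x.2; [exact: tau'K | exact: tauK].
pose a := letter_action LK; exists a.
have at_ g : a (fg_gen t) g = tau g by rewrite /= /L /= eqxx.
have aS m g : a (fg_gen s ^+ m) g = fg_gen s ^+ m * g.
  elim: m => [|m IH]; first by rewrite act1 mul1g.
  by rewrite expgS actM IH /= /L /= (negbTE nst) -mulgA.
split.
  move=> xs ys uxs uys sxy; have [r] := tauP (inl (xs, ys)).
  move=> /(_ uxs uys sxy)[m [k rzip]] taur.
  exists ((fg_gen s ^+ k)^-1 * (fg_gen t * fg_gen s ^+ m)) => //.
  apply: (@eq_from_nth _ 1); rewrite size_map // => i i_lt.
  rewrite (nth_map 1) // !actM at_ aS.
  have /rzip/taur /= -> : (fg_gen s ^+ m * nth 1 xs i, fg_gen s ^+ k * nth 1 ys i)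
    \in zip [seq fg_gen s ^+ m * g | g <- xs] [seq fg_gen s ^+ k * g | g <- ys].
    apply/(nthP (1, 1)); exists i; first by rewrite size_zip !size_map -sxy minnn.
    by rewrite nth_zip ?size_map // !(nth_map 1) // -sxy.
  by apply: (canLR (actK a (fg_gen s ^+ k))); rewrite aS.
(* A word acts as left multiplication at g as soon as tau does so at every point
   of the path of that word from g; the elements hs locate these points
   relatively to g.  A letter (t, false) uses tau at the end of its step. *)
have regular w : exists hs : seq F, forall g,
    (forall h, h \in hs -> tau (h * g) = fg_gen t * (h * g)) ->
    foldr L g w = eval_word w * g.
  elim: w => [|[b c] w [hs hsP]]; first by exists [::] => g _; rewrite mul1g.
  exists [:: eval_word w, letter (t, false) * eval_word w & hs] => g gP /=.
  rewrite hsP; last by move=> h hhs; apply: gP; rewrite !inE hhs !orbT.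
  rewrite /L /=; case: eqP => [->|_]; last by rewrite mulgA.
  case: c; first by rewrite gP ?inE ?eqxx // mulgA.
  apply: (canLR tauK); rewrite gP ?inE ?eqxx ?orbT // !mulgA.
  by rewrite [letter _](letter_invV (t, true)) mulgV mul1g.
move=> g g1 l; have [hs hsP] := regular (word g).
have [r [z zl zr] taur] := tauP (inr (hs, l)); exists z => // gz; apply: g1.
apply: (mulIg z); rewrite mul1g -{2}gz /= hsP ?eval_wordK // => h hhs.
exact: (taur _ (zr h hhs)).
Qed.

End FreeAction.

(** * Subnormal subgroups of highly transitive groups *)

Section NormalSubgroups.
Variables (G : groupType) (T : choiceType) (a : group_action G T).
Hypotheses (Tinf : infinite_type T) (asup : infinite_supports a).
Implicit Types (g : G) (H K N : set G) (xs ys l : seq T).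

Lemma fresh_seq l k :
  exists zs, [/\ size zs = k, uniq zs & {in zs, forall z, z \notin l}].
Proof.
elim: k => [|k [zs [zsk uzs zsl]]]; first by exists [::].
have [z] := Tinf (zs ++ l); rewrite mem_cat negb_or => /andP[zzs zl].
exists (z :: zs); split; rewrite /= ?zsk ?zzs // => y.
by rewrite inE => /orP[/eqP->|/zsl].
Qed.

(** Greedy choice: a new point must avoid the finitely many points already
    listed, their images and their preimages. *)
Lemma displaced_seq g k : g <> 1 ->
  exists2 ps, size ps = k & uniq (ps ++ map (a g) ps).
Proof.
move=> g1; elim: k => [|k [ps psk ups]]; first by exists [::].
have [p] := asup g1 (ps ++ map (a g) ps ++ map (a g^-1) ps).
rewrite !mem_cat !negb_or => /and3P[pps pgps pVps] /eqP gpp.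
exists (p :: ps); rewrite /= ?psk // mem_cat inE !negb_or pps eq_sym gpp pgps.
rewrite uniq_catC /= uniq_catC ups mem_cat (mem_map (@act_inj _ _ a g)).
rewrite (negbTE pps) /= andbT; apply: contra pVps => gpps.
by rewrite -[p](actK a g); apply: map_f.
Qed.

(** Conjugating by [k] in [K] the displacement of a tuple [ps] by [n] in [N]
    gives elements of [N] between any two disjoint tuples; two arbitrary tuples
    are linked through a third one disjoint from both. *)
Lemma highly_transitive_normal K N :
  highly_transitive a K -> normal_subgroup N K -> nontrivial N ->
  highly_transitive a N.
Proof.
move=> aK [[N1 NM NV] NK KN] [n Nn n1].
have aN_disjoint xs ys : uniq (xs ++ ys) -> size xs = size ys ->
    exists2 g, N g & map (a g) xs = ys.
  move=> uxys sxy; have [ps psx ups] := displaced_seq (size xs) n1.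
  have [|k Kk] := aK _ _ uxys ups; first by rewrite !size_cat size_map psx sxy.
  move/eqP; rewrite map_cat eqseq_cat ?size_map // => /andP[/eqP kxs /eqP kys].
  exists (n ^ k); first exact: KN.
  apply: (inj_map (@act_inj _ _ a k)); rewrite kys -kxs -!map_comp.
  by apply: eq_map => x /=; rewrite conjgE !actM actKV.
move=> xs ys uxs uys sxy.
have [zs [zsx uzs zsl]] := fresh_seq (xs ++ ys) (size xs).
have uxz : uniq (xs ++ zs).
  rewrite cat_uniq uxs uzs andbT; apply/hasPn => z /zsl.
  by rewrite mem_cat negb_or => /andP[].
have uzy : uniq (zs ++ ys).
  rewrite uniq_catC cat_uniq uys uzs andbT; apply/hasPn => z /zsl.
  by rewrite mem_cat negb_or => /andP[].
have [//|g Ng gxs] := aN_disjoint _ _ uxz.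
have [|h Nh hzs] := aN_disjoint _ _ uzy; first by rewrite zsx.
exists (h * g); first exact: NM.
by rewrite -hzs -gxs -map_comp; apply: eq_map => x /=; rewrite actM.
Qed.

Lemma highly_transitive_subnormal H :
  highly_transitive a setT -> subnormal H -> nontrivial H ->
  highly_transitive a H.
Proof.
move=> aT [m [C [C0 Cm Cnormal]]] [h Hh h1].
have Ch i : (i <= m)%N -> C i h.
  move=> im; rewrite -(subKn im); elim: (m - i)%N (leq_subr i m) => [|j IH] jm.
    by rewrite subn0 Cm.
  have m_j : (0 < m - j)%N by rewrite subn_gt0.
  have [|_ sub _] := Cnormal (m - j.+1)%N.
    by rewrite subnS prednK // leq_subr.
  by apply: sub; rewrite subnS prednK //; apply: IH; exact: ltnW.
rewrite -Cm; have : (m <= m)%N by [].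
elim: {-2}m => [_|i IH im]; first by rewrite C0.
apply: highly_transitive_normal (IH (ltnW im)) (Cnormal _ im) _.
by exists h => //; apply: Ch.
Qed.


End NormalSubgroups.

(** * The action on two-element subsets *)

Section PairAction.
Variables (G : groupType) (T : countType) (a : group_action G T).
Hypotheses (Tinf : infinite_type T) (ahT : highly_transitive a setT).
Local Open Scope fset_scope.

Definition pair_of : Type := {A : {fset T} | #|` A| == 2}.

Definition Pair (A : {fset T}) (A2 : #|` A| == 2) : pair_of :=
  @exist _ (fun A : {fset T} => #|` A| == 2) A A2.

Implicit Types (g : G) (A B C D : {fset T}) (P Q R S : pair_of).

Lemma map_fset g A B :
  map (a g) (enum_fset A) = enum_fset B -> a g @` A = B.
Proof.
move=> gAB; apply/fsetP => y; rewrite -[y \in B]/(y \in enum_fset B) -gAB.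
by apply/imfsetP/mapP.
Qed.

(** The relative position of two finite sets is determined by three cardinals:
    listing the three parts of their union one after the other reduces to
    tuples. *)
Lemma highly_transitive_fset2 H A B A' B' : highly_transitive a H ->
  #|` A `&` B| = #|` A' `&` B'| -> #|` A `\` B| = #|` A' `\` B'| ->
  #|` B `\` A| = #|` B' `\` A'| ->
  exists g, [/\ H g, a g @` A = A' & a g @` B = B'].
Proof.
move=> aH cI cAB cBA.
pose parts X Y : seq T := enum_fset (X `&` Y) ++ enum_fset (X `\` Y) ++ enum_fset (Y `\` X).
have uparts X Y : uniq (parts X Y).
  rewrite !cat_uniq !fset_uniq /= andbT has_cat negb_or.
  apply/andP; split.
  - apply/andP; split; apply/hasPn => x /=.
      by rewrite !inE => /andP[/negbTE->]; rewrite andbF.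
    by rewrite !inE => /andP[/negbTE->].
  - apply/hasPn => x /=.
    by rewrite !inE => /andP[/negbTE->]; rewrite andbF.
have [|g Hg] := aH _ _ (uparts A B) (uparts A' B').
  by rewrite !size_cat cI cAB cBA.
move/eqP; rewrite !map_cat !eqseq_cat ?size_map //.
case/and3P=> /eqP/map_fset gI /eqP/map_fset gAB /eqP/map_fset gBA.
exists g; split=> //.
  by rewrite -(fsetID B A) imfsetU gI gAB fsetID.
by rewrite -(fsetID A B) imfsetU [B `&` A]fsetIC gI gBA fsetIC fsetID.
Qed.

Lemma pair_act_proof g P : #|` a g @` val P| == 2.
Proof. by rewrite card_imfset ?(valP P) //; exact: act_inj. Qed.

Definition pair_act g P : pair_of := Pair (pair_act_proof g P).

Lemma pair_act1 P : pair_act 1 P = P.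
Proof.
apply: val_inj => /=; rewrite -[RHS]imfset_id; apply: eq_imfset => //.
exact: act1.
Qed.

Lemma pair_actM g h P : pair_act (g * h) P = pair_act g (pair_act h P).
Proof.
apply: val_inj => /=; rewrite -imfset_comp; apply: eq_imfset => // x.
exact: actM.
Qed.

Definition pair_action := GroupAction pair_act1 pair_actM.

Definition meet P Q := #|` val P `&` val Q|.

Lemma meet_act g P Q : meet (pair_action g P) (pair_action g Q) = meet P Q.
Proof.
rewrite /meet /= -imfsetI; last by move=> x y _ _; exact: act_inj.
by rewrite card_imfset //; exact: act_inj.
Qed.

Lemma meetC P Q : meet P Q = meet Q P.
Proof. by rewrite /meet fsetIC. Qed.

Lemma meet_lt2 P Q : P <> Q -> (meet P Q < 2)%N.
Proof.
move=> PQ; rewrite ltnNge; apply/negP => le2; apply: PQ; apply: val_inj.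
have PI : val P `&` val Q = val P.
  by apply/eqP; rewrite eqEfcard fsubsetIl (eqP (valP P)).
have QI : val P `&` val Q = val Q.
  by apply/eqP; rewrite eqEfcard fsubsetIr (eqP (valP Q)).
by rewrite -PI.
Qed.

Lemma pair_orbital H P Q P' Q' : highly_transitive a H ->
  meet P Q = meet P' Q' ->
  exists g, [/\ H g, pair_action g P = P' & pair_action g Q = Q'].
Proof.
move=> aH eqm.
have [|||g [Hg gP gQ]] := @highly_transitive_fset2 H (val P) (val Q) (val P') (val Q') aH.
- exact: eqm.
- by rewrite !cardfsD (eqP (valP P)) (eqP (valP P')); congr (_ - _)%N.
- rewrite !cardfsD (eqP (valP Q)) (eqP (valP Q')); congr (_ - _)%N.
  by rewrite fsetIC [in RHS]fsetIC.
- by exists g; split=> //; exact: val_inj.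
Qed.

(** Each of the two orbital graphs on pairs (sharing no point, sharing exactly
    one) has diameter two.  For [i = 0] take two fresh points.  For [i = 1] take
    a common point and a fresh one if [P] and [Q] meet, and otherwise one point
    of each. *)
Lemma pair_intermediate i P Q : (i < 2)%N ->
  exists R, meet P R = i /\ meet R Q = i.
Proof.
move=> i2.
have meet1 x y (xy : #|` [fset x; y]| == 2) S :
    x \in val S -> y \notin val S -> meet S (Pair xy) = 1%N.
  move=> xS yS; rewrite /meet /=.
  suff -> : val S `&` [fset x; y] = [fset x] by rewrite cardfs1.
  apply/fsetP => z; rewrite !inE; case: (z =P x) => [->|_]; first by rewrite xS.
  by case: (z =P y) => [->|_]; rewrite ?(negbTE yS) ?andbF.
have pairP S : exists x, x \in val S.
  by have /fset0Pn : val S != fset0 by rewrite -cardfs_gt0 (eqP (valP S)).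
case: i i2 => [|[|//]] _.
  have [x] := Tinf (enum_fset (val P `|` val Q)).
  have [y] := Tinf (x :: enum_fset (val P `|` val Q)).
  rewrite !inE !negb_or => /and3P[yx yP yQ] /andP[xP xQ].
  have xy : #|` [fset x; y]| == 2 by rewrite cardfs2 [x == y]eq_sym yx.
  have meet0 S : x \notin val S -> y \notin val S -> meet S (Pair xy) = 0%N.
    move=> xS yS; apply/eqP; rewrite cardfs_eq0; apply/eqP/fsetP => z.
    rewrite !inE; case: (z =P x) => [->|_]; first by rewrite (negbTE xS).
    by case: (z =P y) => [->|_]; rewrite ?(negbTE yS) ?andbF.
  by exists (Pair xy); rewrite [meet _ Q]meetC !meet0.
have [PQ0|/fset0Pn[x]] := eqVneq (val P `&` val Q) fset0.
  have [x xP] := pairP P; have [y yQ] := pairP Q.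
  have nPQ z : z \in val P -> z \notin val Q.
    by move=> zP; have /fsetP/(_ z) := PQ0; rewrite !inE zP => /= ->.
  have yP : y \notin val P by apply: contraL yQ; exact: nPQ.
  have xy : #|` [fset x; y]| == 2.
    by rewrite cardfs2 (_ : x != y) //; apply: contraNneq yP => <-.
  exists (Pair xy); rewrite meet1 // [meet _ Q]meetC; split=> //.
  have yx : #|` [fset y; x]| == 2 by rewrite fsetUC.
  rewrite -(meet1 y x yx Q yQ (nPQ x xP)); congr meet; apply: val_inj => /=.
  exact: fsetUC.
rewrite inE => /andP[xP xQ].
have [y] := Tinf (enum_fset (val P `|` val Q)).
rewrite inE negb_or => /andP[yP yQ].
have xy : #|` [fset x; y]| == 2.
  by rewrite cardfs2 (_ : x != y) //; apply: contraNneq yP => <-.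
by exists (Pair xy); rewrite [meet _ Q]meetC !meet1.
Qed.

Lemma pair_transitive H : highly_transitive a H -> transitive_on pair_action H.
Proof.
move=> aH P Q.
have [|g [Hg gP _]] := @pair_orbital H P P Q Q aH; last by exists g.
by rewrite /meet !fsetIid (eqP (valP P)) (eqP (valP Q)).
Qed.

Lemma other_pair P : exists Q, P <> Q.
Proof.
have [Q [PQ _]] := @pair_intermediate 0 P P isT; exists Q => eqPQ; move: PQ.
by rewrite -eqPQ /meet fsetIid (eqP (valP P)).
Qed.

(** Let [K] contain the stabilizer of [P] and an element [k] moving [P], and let
    [i] be the number of points common to [P] and [k P].  By [pair_orbital] the
    [K]-orbit of [P] contains every pair sharing [i] points with one of its
    members, so by [pair_intermediate] it contains every pair.  A subgroup that
    is transitive and contains a point stabilizer is the whole group. *)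
Lemma pair_primitive : primitive_action pair_action.
Proof.
split.
- have [x _] := Tinf [::]; have [y] := Tinf [:: x].
  rewrite inE eq_sym => xy.
  have c2 : #|` [fset x; y]| == 2 by rewrite cardfs2 xy.
  by exists (Pair c2).
- exact: pair_transitive.
move=> P; split.
- split=> [|g h gP hP|g gP]; rewrite /point_stabilizer /=.
  + exact: pair_act1.
  + by rewrite pair_actM [pair_act h P]hP; exact: gP.
  + by rewrite -{1}[P]gP; exact: (actK pair_action).
- have [Q PQ] := other_pair P.
  have [g _ gP] := pair_transitive ahT P Q.
  move=> stabT; have : point_stabilizer pair_action P g by rewrite stabT.
  by rewrite /point_stabilizer /= -[LHS]/(pair_action g P) gP => /esym.
move=> K [K1 KM KV] stabK.
have [KP|] := pselect (K `<=` point_stabilizer pair_action P)%classic.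
  by left; apply/seteqP.
move=> /existsNP[k /not_implyP[Kk kP]]; right.
apply/seteqP; split=> // g _.
pose i := meet P (pair_action k P).
have i2 : (i < 2)%N by apply: meet_lt2 => /esym.
have orbK h Q : K h -> meet (pair_action h P) Q = i ->
    exists2 h', K h' & pair_action h' P = Q.
  move=> Kh hQ.
  have [|s [_ sP skP]] := @pair_orbital setT P (pair_action k P) P
    (pair_action h^-1 Q) ahT.
    by rewrite -/i -hQ -(meet_act h^-1) actK.
  exists (h * (s * k)); first by apply: (KM) => //; apply: KM => //; exact: stabK.
  by rewrite !actM skP actKV.
have [Q [PQ Qg]] := pair_intermediate P (pair_action g P) i2.
have [|h Kh hP] := orbK 1 Q K1; first by rewrite act1.
have [|h' Kh' h'P] := orbK h (pair_action g P) Kh; first by rewrite hP.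
rewrite -(mulVKg h' g); apply: KM => //; apply: stabK.
by rewrite /point_stabilizer /= -[LHS]/(pair_action _ P) actM -h'P actK.
Qed.

Lemma pair_not_two_transitive : ~ two_transitive_action pair_action.
Proof.
have [P _] : [set: pair_of]%classic !=set0 by have [] := pair_primitive.
have [Q [PQ _]] := @pair_intermediate 0 P P isT.
have [R [PR _]] := @pair_intermediate 1 P P isT.
have neq i S : (i < 2)%N -> meet P S = i -> P <> S.
  move=> i2 PS eqPS; move: PS i2; rewrite -eqPS /meet fsetIid (eqP (valP P)).
  by move=> <-.
move=> /(_ P Q P R (neq 0%N Q isT PQ) (neq 1%N R isT PR))[g [gP gQ]].
by move: (meet_act g P Q); rewrite gP gQ PQ PR.
Qed.

(** An element fixing all the points that occur in members of [Y] while moving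
    one more point [p] to another point [q]. *)
Lemma pair_stabilizer_nontrivial (Y : set pair_of) : finite_set Y ->
  nontrivial (pointwise_stabilizer pair_action Y).
Proof.
move=> /finite_seqP[s ->].
pose l := undup (flatten [seq enum_fset (val P) | P : pair_of <- s]).
have [p pl] := Tinf l; have [q] := Tinf (p :: l).
rewrite inE negb_or => /andP[qp ql].
have [||| g _ /eqP] := ahT (xs := rcons l p) (ys := rcons l q).
- by rewrite rcons_uniq pl undup_uniq.
- by rewrite rcons_uniq ql undup_uniq.
- by rewrite !size_rcons.
rewrite map_rcons eqseq_rcons => /andP[/eqP gl /eqP gp]; exists g; last first.
  by move=> g1; move: gp qp; rewrite g1 act1 => ->; rewrite eqxx.
move=> P /= Ps; apply: val_inj => /=; rewrite -[RHS]imfset_id.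
apply: eq_in_imfset => // x xP; move: gl; rewrite -[RHS]map_id => /eq_in_map.
apply; rewrite mem_undup; apply/flattenP; exists (enum_fset (val P)) => //.
exact: map_f.
Qed.

End PairAction.

Theorem corollary2 :
  forall n : nat, (2 <= n)%N ->
  exists (X : Type) (a : group_action (free_group 'I_n) X),
    [/\ countable [set: X],
        primitive_action a,
        ~ two_transitive_action a,
        forall Y : set X, finite_set Y ->
          nontrivial (pointwise_stabilizer a Y) &
        forall H : set (free_group 'I_n),
          subnormal H -> nontrivial H -> transitive_on a H].
Proof.
case=> [|[|n]] // _.
have neq01 : ord0 != lift ord0 ord0 :> 'I_n.+2 by [].
have [a [ahT asup]] := free_group_highly_transitive_action neq01.
have Finf := free_group_infinite (ord0 : 'I_n.+2).
exists (pair_of _), (pair_action a); split.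
- exact: countableP.
- exact: pair_primitive.
- exact: pair_not_two_transitive.
- by move=> Y; apply: pair_stabilizer_nontrivial.
- move=> H Hsub Hnontriv; apply: pair_transitive.
  exact: highly_transitive_subnormal.
Qed.
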